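(* Let $F:\mathbb{R}^n\to\mathbb{R}^m$, let $D\subset\mathbb{R}^m$ be closed, let $\Omega=\{x\in\mathbb{R}^n\mid F(x)\in D\}$, let $\bar x\in\Omega$, let $F$ be continuously differentiable at $\bar x$, and assume that GGCQ holds at $\bar x$. Then for every nonempty convex cone $Q\subset\mathbb{R}^m$ satisfying $$\widehat N_\Omega(\bar x)\subset\{u\in\mathbb{R}^n\mid\nabla F(\bar x)u\in Q\}^\circ$$ there holds $$\widehat N_\Omega(\bar x)=(\bar{\mathcal C}(Q))^\circ.$$
   Context: A cone is a set $K$ with $\lambda K\subset K$ for all $\lambda\ge 0$ (so a nonempty cone contains $0$). $K^\circ=\{z^*\mid \langle z^*,u\rangle\le 0\ \forall u\in K\}$ is the polar. For $\Gamma\subset\mathbb{R}^d$, $\bar z\in\Gamma$: $T_\Gamma(\bar z)=\{u\mid \exists t_k\searrow 0,\ u_k\to u:\ \bar z+t_ku_k\in\Gamma\ \forall k\}$ and $\widehat N_\Gamma(\bar z)=(T_\Gamma(\bar z))^\circ$. GGCQ at $\bar x$: $(T_\Omega(\bar x))^\circ=(T^{\rm lin}_\Omega(\bar x))^\circ$ where $T^{\rm lin}_\Omega(\bar x)=\{u\mid\nabla F(\bar x)u\in T_D(F(\bar x))\}$. For a nonempty convex cone $Q\subset\mathbb{R}^m$ put $$\bar{\mathcal T}(Q):=T_D(F(\bar x))\cap\Big(\big({\rm Range}\,\nabla F(\bar x)\cap T_D(F(\bar x))\big)+Q\Big),$$ i.e. the set of all $t\in T_D(F(\bar x))$ for which there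 are $u\in\mathbb{R}^n$, $q\in Q$ with $\nabla F(\bar x)u=t-q\in T_D(F(\bar x))$, and $$\bar{\mathcal C}(Q):=\{u\in\mathbb{R}^n\mid\nabla F(\bar x)u\in{\rm conv}\,\bar{\mathcal T}(Q)\}.$$ *)

(* Defs.v *)
From HB Require Import structures.
From mathcomp Require Import all_boot all_order all_algebra.
From mathcomp Require Import all_classical all_reals all_analysis.

Set Implicit Arguments.
Unset Strict Implicit.
Unset Printing Implicit Defensive.

Import Order.TTheory GRing.Theory Num.Theory.
Import numFieldNormedType.Exports.

Local Open Scope classical_set_scope.
Local Open Scope ring_scope.

(* R^d is 'rV[R]_d; the library norm on it is the sup norm, which induces the
   usual topology.  The derivative of F at x applied to u is 'd F x u, which is
   u *m 'J F x in coordinates. *)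

Definition dot (R : realType) (d : nat) (u v : 'rV[R]_d) : R :=
  \sum_(i < d) u 0 i * v 0 i.

Definition cone (R : realType) (d : nat) (K : set 'rV[R]_d) : Prop :=
  forall l : R, 0 <= l -> [set l *: u | u in K] `<=` K.

Definition polar (R : realType) (d : nat) (K : set 'rV[R]_d) : set 'rV[R]_d :=
  [set z | forall u, K u -> dot z u <= 0].

Definition conv_hull (R : realType) (d : nat) (A : set 'rV[R]_d) :
    set 'rV[R]_d :=
  smallest [set B : set 'rV[R]_d | convex_set B] A.

Definition tangent_cone (R : realType) (d : nat) (G : set 'rV[R]_d)
    (z : 'rV[R]_d) : set 'rV[R]_d :=
  [set u | exists (t : nat -> R) (v : nat -> 'rV[R]_d),
    [/\ forall k, 0 < t k, t @ \oo --> 0, v @ \oo --> u &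
        forall k, G (z + t k *: v k)]].

Definition regular_normal_cone (R : realType) (d : nat) (G : set 'rV[R]_d)
    (z : 'rV[R]_d) : set 'rV[R]_d :=
  polar (tangent_cone G z).

(* Differentiable on a neighbourhood of x, with a derivative that is required
   to be continuous at the point x only. *)
Definition continuously_differentiable_at (R : realType) (n m : nat)
    (F : 'rV[R]_n -> 'rV[R]_m) (x : 'rV[R]_n) : Prop :=
  (\forall y \near x, differentiable F y) /\
  {for x, continuous (jacobian F)}.

Definition linearized_tangent_cone (R : realType) (n m : nat)
    (F : 'rV[R]_n -> 'rV[R]_m) (D : set 'rV[R]_m) (x : 'rV[R]_n) :
    set 'rV[R]_n :=
  [set u | tangent_cone D (F x) ('d F x u)].

(* Generalized Guignard constraint qualification for F @^-1` D at x. *)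
Definition GGCQ (R : realType) (n m : nat)
    (F : 'rV[R]_n -> 'rV[R]_m) (D : set 'rV[R]_m) (x : 'rV[R]_n) : Prop :=
  polar (tangent_cone (F @^-1` D) x) = polar (linearized_tangent_cone F D x).

Definition Tbar (R : realType) (n m : nat)
    (F : 'rV[R]_n -> 'rV[R]_m) (D : set 'rV[R]_m) (x : 'rV[R]_n)
    (Q : set 'rV[R]_m) : set 'rV[R]_m :=
  tangent_cone D (F x) `&`
  [set w + q | w in range ('d F x) `&` tangent_cone D (F x) & q in Q].

Definition Cbar (R : realType) (n m : nat)
    (F : 'rV[R]_n -> 'rV[R]_m) (D : set 'rV[R]_m) (x : 'rV[R]_n)
    (Q : set 'rV[R]_m) : set 'rV[R]_n :=
  [set u | conv_hull (Tbar F D x Q) ('d F x u)].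

(* Main.v *)
Require Import Defs.
From HB Require Import structures.
From mathcomp Require Import all_boot all_order all_algebra.
From mathcomp Require Import all_classical all_reals all_analysis.
Import Order.TTheory GRing.Theory Num.Theory.
Import numFieldNormedType.Exports.
Local Open Scope classical_set_scope.
Local Open Scope ring_scope.

(** Write [A] for the derivative of [F] at [xbar] and [T] for the tangent cone
of [D] at [F xbar].  By the constraint qualification the normal cone is the
polar of the preimage [A^-1 T], and the task is to show that [A^-1 T] and
[Cbar] have the same polar.

As a nonempty cone, [Q] contains [0]; hence [A^-1 T] is contained in [Cbar],
and the polar of [Cbar] is contained in the normal cone.

Conversely, fix a regular normal [z].  Every point of [Tbar] has the form
[A w + q] with [q] in [Q] and [A w] in [T], whence [dot z w <= 0].  The points
of the form [A w + q] with [dot z w <= 0] and [q] in [Q] make up a convex set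
([convex_image_halfspaceD]), which therefore contains all of [conv Tbar].  If
[A u = A w + q] is such a point, then [A (u - w) = q] lies in [Q], so the
hypothesis on [Q] gives [dot z (u - w) <= 0], and adding [dot z w <= 0] yields
[dot z u <= 0]. *)

Lemma dotDr (R : realType) (d : nat) (z u v : 'rV[R]_d) :
  dot z (u + v) = dot z u + dot z v.
Proof. by rewrite /dot -big_split; apply: eq_bigr => i _; rewrite mxE mulrDr. Qed.

Lemma dotZr (R : realType) (d : nat) (z u : 'rV[R]_d) (a : R) :
  dot z (a *: u) = a * dot z u.
Proof. by rewrite /dot mulr_sumr; apply: eq_bigr => i _; rewrite mxE mulrCA. Qed.

Lemma cone0 (R : realType) (d : nat) (K : set 'rV[R]_d) :
  K !=set0 -> cone K -> K 0.
Proof. by move=> [k Kk] cK; apply: (cK 0 (lexx 0)); exists k; rewrite ?scale0r. Qed.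

Lemma polarS (R : realType) (d : nat) (K L : set 'rV[R]_d) :
  K `<=` L -> polar L `<=` polar K.
Proof. by move=> KL z Lz u /KL; exact: Lz. Qed.

Lemma sub_conv_hull (R : realType) (d : nat) (K : set 'rV[R]_d) :
  K `<=` conv_hull K.
Proof. exact: sub_smallest. Qed.

Lemma conv_hull_min (R : realType) (d : nat) (K B : set 'rV[R]_d) :
  convex_set B -> K `<=` B -> conv_hull K `<=` B.
Proof. exact: smallest_sub. Qed.

(** Keeping only the inequality [dot z w <= 0] from [A w] being tangent makes
the decompositions [A w + q] stable under convex combinations, whereas the
tangent cone itself need not be convex.  This set is the convex upper bound of
the hull of [Tbar]. *)
Lemma convex_image_halfspaceD (R : realType) (n m : nat)
    (A : {linear 'rV[R]_n -> 'rV[R]_m}) (z : 'rV[R]_n) (Q : set 'rV[R]_m) :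
  convex_set Q ->
  convex_set [set A w + q | w in [set w | dot z w <= 0] & q in Q].
Proof.
move=> cQ x y l; rewrite !inE => -[w zw [q Qq <-]] [w' zw' [q' Qq' <-]].
exists (l%:num *: w + (1 - l%:num) *: w').
  rewrite /= dotDr !dotZr -[leRHS]addr0.
  by rewrite lerD// mulr_ge0_le0// subr_ge0.
exists (l%:num *: q + (1 - l%:num) *: q').
  by apply: set_mem; apply: (cQ q q' l); exact: mem_set.
by rewrite linearD !linearZ /= addrACA -!scalerDr.
Qed.

Theorem theorem4 (R : realType) (n m : nat)
    (F : 'rV[R]_n -> 'rV[R]_m) (D : set 'rV[R]_m)
    (Omega : set 'rV[R]_n) (xbar : 'rV[R]_n)
    (hD : closed D)
    (hOmega : Omega = [set x | D (F x)])
    (hxbar : Omega xbar)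
    (hF : continuously_differentiable_at F xbar)
    (hGGCQ : GGCQ F D xbar)
    (Q : set 'rV[R]_m)
    (hQ0 : Q !=set0) (hQcone : cone Q) (hQconvex : convex_set Q)
    (hQ : regular_normal_cone Omega xbar `<=`
          polar [set u : 'rV[R]_n | Q ('d F xbar u)]) :
  regular_normal_cone Omega xbar = polar (Cbar F D xbar Q).
Proof.
have NE : regular_normal_cone Omega xbar =
    polar (linearized_tangent_cone F D xbar) by rewrite hOmega -hGGCQ.
apply/seteqP; split=> [z Nz u|].
- move=> /(conv_hull_min _ _ _ _ (convex_image_halfspaceD _ _ _ ('d F xbar) z _ hQconvex)).
  case=> [t [_ [_ [[w _ <-] Tw] [q Qq <-]]]|w zw [q Qq Auq]].
    exists w; last by exists q.
    by move: (Nz); rewrite NE; apply.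
  have zuw : dot z (u - w) <= 0.
    apply: (hQ _ Nz); rewrite /= linearB /= -Auq.
    by rewrite [_ + q]addrC addrK.
  by rewrite -(subrK w u) dotDr -[leRHS]addr0 lerD.
- rewrite NE; apply: polarS => u Tu.
  apply: sub_conv_hull; split=> //.
  exists ('d F xbar u); first by split=> //; exists u.
  by exists 0; [exact: cone0|rewrite addr0].
Qed.
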